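(* Let $L$ be a compactly generated multiplicative lattice in which the top element $1$ is compact and every finite product of compact elements is compact, and suppose $L$ is $z$-Noetherian. Then every $z$-element of $L$ can be represented as a meet of a finite number of $z$-irreducible elements of $L$.
   Context: A multiplicative lattice is a complete lattice $(L,\leqslant,0,1)$ endowed with an associative, commutative multiplication which distributes over arbitrary joins and has $1$ as multiplicative identity. An element $c\in L$ is compact if for any $\{x_\lambda\}_{\lambda\in\Lambda}\subseteq L$, $c\leqslant\bigvee_{\lambda\in\Lambda}x_\lambda$ implies $c\leqslant\bigvee_{i=1}^n x_{\lambda_i}$ for some $n\in\mathbb{N}^+$ and $\lambda_1,\dots,\lambda_n\in\Lambda$; $L$ is compactly generated if every element of $L$ is a join of compact elements. An element $m\neq 1$ is maximal if $m\leqslant x$ and $x<1$ imply $m=x$, for all $x\in L$; $\mathcal{M}(L)$ is the set of maximal elements. For $a\in L$ put $\mathcal{M}_a=\{m\in\mathcal{M}(L)\mid a\leqslant m\}$. An element $x\in L$ is a $z$-element if for all $a,b\in L$, $\mathcal{M}_a=\mathcal{M}_b$ and $b\leqslant x$ imply $a\leqslant x$. $L$ is $z$-Noetherian if every ascending chain of $z$-elements in $L$ is eventually stationary. A $z$-element $s$ is $z$-irreducible if for all $z$-elements $a,b$ of $L$, $a\wedge b=s$ implies $a=s$ or $b=s$. *)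

(* Defs.v *)
From HB Require Import structures.
From mathcomp Require Import all_boot all_order.
From mathcomp Require Import boolp classical_sets.

Set Implicit Arguments.
Unset Strict Implicit.
Unset Printing Implicit Defensive.

Import Order.TTheory.

Local Open Scope classical_set_scope.
Local Open Scope order_scope.

(* Arbitrary meets need no separate field: they are the joins of the sets of
   lower bounds. *)
HB.mixin Record TBLattice_isComplete d L of Order.TBLattice d L := {
  bigsup : set L -> L;
  bigsup_supremums : forall A : set L, supremums A (bigsup A)
}.

#[short(type="completeLatticeType")]
HB.structure Definition CompleteLattice d :=
  { L of Order.TBLattice d L & TBLattice_isComplete d L }.

HB.mixin Record CompleteLattice_isMultiplicative d L
    of CompleteLattice d L := {
  lmul : L -> L -> L;
  lmulA : associative lmul;
  lmulC : commutative lmul;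
  lmul1x : left_id \top lmul;
  lmul_bigsupr : forall (a : L) (B : set L),
    lmul a (bigsup B) = bigsup [set lmul a b | b in B]
}.

#[short(type="multLatticeType")]
HB.structure Definition MultLattice d :=
  { L of CompleteLattice d L & CompleteLattice_isMultiplicative d L }.

HB.instance Definition _ d (L : multLatticeType d) :=
  Monoid.isComLaw.Build L \top lmul lmulA lmulC lmul1x.

Section MultiplicativeLattice.
Context {d : Order.disp_t} {L : multLatticeType d}.
Implicit Types (a b c m s x : L) (A : set L).

(* Families are nonempty, as the index n >= 1 of the finite subfamily
   requires; in particular \bot is compact. *)
Definition compact_element c :=
  forall A, A !=set0 -> c <= bigsup A ->
    exists (n : nat) (x : 'I_n.+1 -> L),
      (forall i, A (x i)) /\ c <= \join_(i < n.+1) x i.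

Definition maximal_element m :=
  m <> \top /\ forall x, m <= x -> x < \top -> m = x.

Definition maximals_above a : set L := [set m | maximal_element m /\ a <= m].

Definition z_element x :=
  forall a b, maximals_above a = maximals_above b -> b <= x -> a <= x.

Definition z_irreducible s :=
  z_element s /\
  forall a b, z_element a -> z_element b -> a `&` b = s -> a = s \/ b = s.

End MultiplicativeLattice.

Definition compactly_generated {d} (L : multLatticeType d) :=
  forall x : L, exists A : set L, A `<=` compact_element /\ x = bigsup A.

Definition z_noetherian {d} (L : multLatticeType d) :=
  forall u : nat -> L,
    (forall n, z_element (u n)) -> (forall n, u n <= u n.+1) ->
    exists N : nat, forall n, (N <= n)%N -> u n = u N.

(* Main.v *)
(* Noetherian induction: a z-element without such a representation is not
   z-irreducible, hence is a meet of two strictly larger z-elements, one of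
   which again has no representation; iterating gives a strictly ascending
   chain of z-elements. *)
Require Import Defs.
From HB Require Import structures.
From mathcomp Require Import all_boot all_order.
From mathcomp Require Import boolp classical_sets.
Import Order.TTheory.
Local Open Scope order_scope.

(** The index type ['I_n.+1] excludes the empty meet, so [\top] is not represented for free. *)
Definition finite_z_irreducible_meet {d : Order.disp_t} {L : multLatticeType d}
    (s : L) : Prop :=
  exists (n : nat) (t : 'I_n.+1 -> L),
    (forall i, z_irreducible (t i)) /\ s = \meet_(i < n.+1) t i.

Lemma z_irreducible_finite_meet (d : Order.disp_t) (L : multLatticeType d)
  (s : L) : z_irreducible s -> finite_z_irreducible_meet s.
Proof. by move=> s_irr; exists 0, (fun=> s); rewrite big_ord1. Qed.

Lemma finite_z_irreducible_meetI (d : Order.disp_t) (L : multLatticeType d)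
  (a b : L) :
  finite_z_irreducible_meet a -> finite_z_irreducible_meet b ->
  finite_z_irreducible_meet (a `&` b).
Proof.
move=> [m [t [t_irr ->]]] [n [u [u_irr ->]]].
(* With this witness the size [(m + n.+1).+1] is convertible to [m.+1 + n.+1], so [split] applies
   without a cast. *)
exists (m + n.+1)%N, (fun i : 'I_(m.+1 + n.+1) =>
  match @split m.+1 n.+1 i with inl j => t j | inr k => u k end).
split=> [i|]; first by case: split.
rewrite (@big_split_ord _ _ _ m.+1 n.+1); congr (_ `&` _).
  by apply: eq_bigr => j _; rewrite (unsplitK (inl j)).
by apply: eq_bigr => k _; rewrite (unsplitK (inr k)).
Qed.

(** As [s] is a z-element, only the meet clause of [z_irreducible] can fail; a meet lies below both
    factors, so differing from them makes it strictly smaller. *)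
Lemma not_z_irreducibleP (d : Order.disp_t) (L : multLatticeType d) (s : L) :
  z_element s -> ~ z_irreducible s ->
  exists a b, [/\ z_element a, z_element b, s < a, s < b & a `&` b = s].
Proof.
move=> s_z s_red; apply: contrapT => no_ab; apply: s_red.
split=> // a b az bz abE.
apply: contrapT => /not_orP [/eqP a_neq /eqP b_neq]; apply: no_ab; exists a, b.
by split=> //; rewrite lt_neqAle eq_sym ?a_neq ?b_neq -abE ?leIl ?leIr.
Qed.

(** The chain condition makes [>] well-founded on z-elements, by dependent choice. *)
Lemma z_noetherian_ind (d : Order.disp_t) (L : multLatticeType d)
  (P : L -> Prop) :
  z_noetherian L ->
  (forall x, z_element x -> (forall y, z_element y -> x < y -> P y) -> P x) ->
  forall x, z_element x -> P x.
Proof.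
move=> L_zN IH s s_z; apply: contrapT => s_bad.
pose bad x := z_element x /\ ~ P x.
(* The implication sits under the existential so that [f] is total; when [x] is not bad, [x] itself
   is a dummy value. *)
have /choice [f fP] (x : L) : exists y, bad x -> bad y /\ x < y.
  have [[x_z x_bad]|] := pselect (bad x); last by exists x.
  apply: contrapT => no_y; apply: x_bad; apply: IH => // y y_z lt_xy.
  by apply: contrapT => y_bad; apply: no_y; exists y.
have u_bad n : bad (iter n f s) by elim: n => [//|n /fP[]].
have u_lt n : iter n f s < iter n.+1 f s by have [] := fP _ (u_bad n).
have [|n|N uN] := L_zN (fun n => iter n f s).
- by move=> n; case: (u_bad n).
- exact: ltW.
(* Stationarity at [N] would identify two consecutive iterates. *)
- by have := u_lt N; rewrite (uN N.+1 (leqnSn N)) ltxx.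
Qed.

Theorem theorem5p5 (d : Order.disp_t) (L : multLatticeType d)
  (L_cg : compactly_generated L)
  (top_compact : compact_element (\top : L))
  (prod_compact : forall (n : nat) (c : 'I_n -> L),
    (forall i, compact_element (c i)) ->
    compact_element (\big[lmul / \top]_(i < n) c i))
  (L_zN : z_noetherian L)
  (s : L) (s_z : z_element s) :
  exists (n : nat) (t : 'I_n.+1 -> L),
    (forall i, z_irreducible (t i)) /\ s = \meet_(i < n.+1) t i.
Proof.
apply: (z_noetherian_ind _ _ finite_z_irreducible_meet L_zN) s_z => x x_z IH.
have [|x_red] := pselect (z_irreducible x).
  exact: z_irreducible_finite_meet.
have [a [b [a_z b_z lt_xa lt_xb <-]]] := not_z_irreducibleP _ _ _ x_z x_red.
by apply: finite_z_irreducible_meetI; apply: IH.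
Qed.
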